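(* Let $l$ and $a$ be real-valued $1$-periodic functions of class $C^{2+\alpha}$ for some $\alpha>0$, with $\min_{[0,1]}l=1$ and $\max_{[0,1]}|a|=1$. For $L_0>0$, $A_0\ge0$, $\omega>0$, let $$L(t)=L_0\,l\left(\frac{\omega t}{2\pi}\right),\qquad A(t)=A_0\,a\left(\frac{\omega t}{2\pi}\right),$$ and let $\mu(\omega)$ be the principal periodic eigenvalue associated with the $\frac{2\pi}{\omega}$-periodic domain $\Omega(t)=(A(t),A(t)+L(t))$. Then $\mu(\omega)=O(\omega^2)$ as $\omega\to\infty$, and if $a$ is constant, then $\mu(\omega)=O(1)$ as $\omega\to\infty$. Moreover, if $a$ is non-constant, there exist constants $C_1,C_2$ depending only on the functions $l$ and $a$ such that: 1. if $\frac{A_0}{L_0}<C_1$ then $\mu(\omega)=O(1)$ as $\omega\to\infty$; 2. if $\frac{A_0}{L_0}>C_2$ then $\mu(\omega)$ is exactly of order $\omega^2$ as $\omega\to\infty$, i.e. $\mu(\omega)=O(\omega^2)$ and $\omega^2=O(\mu(\omega))$ as $\omega\to\infty$.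
   Context: $D>0$ is a constant. For a $T$-periodic interval $(A(t),A(t)+L(t))$ with $T=\frac{2\pi}{\omega}$, the principal periodic eigenvalue is the unique real number $\mu$ for which there is a function $\phi(\xi,t)$ (unique up to scaling), positive for $0<\xi<L_0$, zero at $\xi=0$ and $\xi=L_0$, $T$-periodic in $t$, with $$\frac{\partial\phi}{\partial t}-D\frac{L_0^2}{L(t)^2}\frac{\partial^2\phi}{\partial\xi^2}-\left(\frac{\dot A(t)L_0+\xi\dot L(t)}{L(t)}\right)\frac{\partial\phi}{\partial\xi}=\mu\phi\qquad\text{for }0<\xi<L_0,\ t\in\mathbb{R}.$$ This comes from $\partial_t\psi=D\,\partial_x^2\psi+\mu\psi$ on $A(t)<x<A(t)+L(t)$ with zero Dirichlet conditions, via $\xi=\frac{x-A(t)}{L(t)}L_0$. *)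

(* Defs.v *)
(* Stdlib reals with Coquelicot. *)
From Stdlib Require Export Reals.
From Coquelicot Require Export Coquelicot.
Open Scope R_scope.

Definition periodic (T : R) (f : R -> R) : Prop :=
  forall t, f (t + T) = f t.

Definition is_constant (f : R -> R) : Prop :=
  exists c, forall t, f t = c.

(* The class C^{k+alpha} on R.  The bound is global, which for the periodic
   functions considered here is the same as the local one.  For alpha > 1 the
   bound makes the k-th derivative constant; this loses nothing when alpha is
   existentially quantified, since periodic functions of higher regularity
   satisfy the bound with a smaller alpha.  [Rpower 0 alpha = 1] is harmless:
   the left-hand side vanishes when x = y. *)
Definition holder_class (k : nat) (alpha : R) (f : R -> R) : Prop :=
  (forall n x, (n <= k)%nat -> ex_derive_n f n x) /\
  (exists K, forall x y,
     Rabs (Derive_n f k x - Derive_n f k y) <= K * Rpower (Rabs (x - y)) alpha).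

Definition is_min_on (f : R -> R) (x0 x1 m : R) : Prop :=
  (exists x, x0 <= x <= x1 /\ f x = m) /\
  (forall x, x0 <= x <= x1 -> m <= f x).

Definition is_max_on (f : R -> R) (x0 x1 m : R) : Prop :=
  (exists x, x0 <= x <= x1 /\ f x = m) /\
  (forall x, x0 <= x <= x1 -> f x <= m).

(* f(w) = O(g(w)) as w -> +infinity. *)
Definition bigO (f g : R -> R) : Prop :=
  exists K, Rbar_locally p_infty (fun w => Rabs (f w) <= K * Rabs (g w)).

Definition exact_order (f g : R -> R) : Prop := bigO f g /\ bigO g f.

(* Regularity of a classical solution: phi is continuous on the closed strip
   [0,L0] x R, and phi_t, phi_xi, phi_xixi exist and are (jointly) continuous
   in its interior.  The values of phi outside the strip are irrelevant. *)
Definition classical_regularity (L0 : R) (phi : R -> R -> R) : Prop :=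
  continuous_on (fun p : R * R => 0 <= fst p <= L0)
    (fun p : R * R => phi (fst p) (snd p)) /\
  (forall xi t, 0 < xi < L0 ->
     ex_derive (fun s => phi xi s) t /\
     ex_derive (fun z => phi z t) xi /\
     ex_derive_n (fun z => phi z t) 2 xi /\
     continuous (fun p : R * R => Derive (fun s => phi (fst p) s) (snd p))
       (xi, t) /\
     continuous (fun p : R * R => Derive (fun z => phi z (snd p)) (fst p))
       (xi, t) /\
     continuous (fun p : R * R => Derive_n (fun z => phi z (snd p)) 2 (fst p))
       (xi, t)).

(* phi is a principal periodic eigenfunction, with eigenvalue mu, for the
   T-periodic interval (A(t), A(t) + L(t)), in the variables (xi, t) where
   xi = (x - A(t)) / L(t) * L0 ranges over (0, L0). *)
Definition principal_eigenfunction
    (D L0 T : R) (A L : R -> R) (mu : R) (phi : R -> R -> R) : Prop :=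
  classical_regularity L0 phi /\
  (forall xi t, 0 < xi < L0 -> 0 < phi xi t) /\
  (forall t, phi 0 t = 0 /\ phi L0 t = 0) /\
  (forall xi, 0 <= xi <= L0 -> periodic T (phi xi)) /\
  (forall xi t, 0 < xi < L0 ->
     Derive (fun s => phi xi s) t
     - D * (L0 ^ 2 / L t ^ 2) * Derive_n (fun z => phi z t) 2 xi
     - (Derive A t * L0 + xi * Derive L t) / L t * Derive (fun z => phi z t) xi
     = mu * phi xi t).

(* At most one mu has this property (for T-periodic A and L > 0 of class C^2),
   so the predicate identifies "the" principal periodic eigenvalue. *)
Definition principal_periodic_eigenvalue
    (D L0 T : R) (A L : R -> R) (mu : R) : Prop :=
  exists phi, principal_eigenfunction D L0 T A L mu phi.

(* t |-> c * f (w t / (2 pi)), which is (2 pi / w)-periodic if f is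
   1-periodic. *)
Definition rescale (c w : R) (f : R -> R) : R -> R :=
  fun t => c * f (w * t / (2 * PI)).

(* mu(w) is, for every w > 0, the principal periodic eigenvalue of the domain
   (A(t), A(t) + L(t)) with A = A0 a(w t / 2 pi) and L = L0 l(w t / 2 pi). *)
Definition eigenvalue_family
    (D L0 A0 : R) (l a : R -> R) (mu : R -> R) : Prop :=
  forall w, 0 < w ->
    principal_periodic_eigenvalue D L0 (2 * PI / w)
      (rescale A0 w a) (rescale L0 w l) (mu w).

(* Main.v *)
Require Import Defs.
From Stdlib Require Import Reals Lra Psatz ZArith IndefiniteDescription.
From Coquelicot Require Import Coquelicot.
Open Scope R_scope.

(** In the fixed coordinate [x] an eigenfunction solves
    [psi_t - D psi_xx = mu psi] on the moving interval and vanishes at its ends.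
    Everything follows from comparing it with explicit functions.

    From above ([eigenvalue_ge]): if [v > 0] is periodic, positive up to the
    boundary, and [v_t - D v_xx >= lam v], then the smallest multiple of [v]
    above [psi] touches it at an interior point, and comparing the two equations
    there gives [mu >= lam].  Constants give [mu >= 0], so that only upper bounds
    remain to be proved for the [O] statements.

    From below ([eigenvalue_le]): a bump supported in an interval
    [[x0(t) - r, x0(t) + r]] that stays inside the domain can be pushed up under
    [psi] until it touches, and [mu <= (r V + 3 D)^2 / (2 D r^2)] where [V]
    bounds the speed of [x0].  Following the midpoint of the domain costs a
    speed of order [w], hence [mu = O(w^2)].  If [a] is constant, or if
    [A0 / L0 < 1/2], some fixed interval lies in the domain at all times; then
    [V = 0] and [mu = O(1)].

    For large [A0 / L0] the lower bound of order [w^2] comes from a plane wave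
    [v = exp (w (p(s) x + h(s)))] with [s = w t / (2 pi)], for which
    [(v_t - D v_xx) / v = w^2 / (2 pi) (p' x + h' - 2 pi D p^2)].  With
    [p = - d a'] the mean over a period of [p' A0 a] is [d A0 m], where [m] is
    the mean of [a'^2], by an integration by parts; the width of the domain
    contributes at most [d L0 sup |a''| sup l] with the wrong sign, and the last
    term is of order [d^2].  So [h] can be chosen to make this quotient positive
    everywhere, for small [d], as soon as [A0 m > L0 sup |a''| sup l], which is
    the condition with [C2 = sup |a''| sup l / m] ([family_ge]). *)

(** * Periodic functions *)

Lemma periodic_shift : forall T f (n : Z) x,
  periodic T f -> f (x + IZR n * T) = f x.
Proof.
  intros T f n x Hf. revert x.
  assert (Hnat : forall k x, f (x + INR k * T) = f x).
  { induction k as [|k IH]; intros x.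
    - f_equal; simpl; ring.
    - rewrite S_INR. replace (x + (INR k + 1) * T) with (x + INR k * T + T) by ring.
      now rewrite Hf. }
  intros x. destruct (Z_le_gt_dec 0 n) as [Hn|Hn].
  - rewrite <- (Z2Nat.id n Hn), <- INR_IZR_INZ. apply Hnat.
  - rewrite <- (Hnat (Z.to_nat (- n)) (x + IZR n * T)).
    f_equal. rewrite INR_IZR_INZ, Z2Nat.id by lia. rewrite opp_IZR. ring.
Qed.

(** The representative [y] is the same for all [f], so several periodic
    functions can be moved to one period at once. *)
Lemma periodic_representative : forall T x, 0 < T ->
  exists y, 0 <= y <= T /\ forall f, periodic T f -> f x = f y.
Proof.
  intros T x HT.
  exists (x + IZR (- Int_part (x / T)) * T). split.
  - rewrite opp_IZR. destruct (base_Int_part (x / T)) as [H1 H2].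
    assert (Hx : x = x / T * T) by (field; lra).
    assert (Hp : 0 <= x / T - IZR (Int_part (x / T)) <= 1) by lra.
    replace (x + - IZR (Int_part (x / T)) * T)
      with ((x / T - IZR (Int_part (x / T))) * T) by (rewrite Hx at 3; ring).
    nra.
  - intros f Hf. symmetry. now apply periodic_shift.
Qed.

Lemma periodic_Derive : forall T f, periodic T f -> periodic T (Derive f).
Proof.
  intros T f Hf t. unfold Derive. f_equal. apply Lim_ext. intros h.
  replace (t + T + h) with (t + h + T) by ring. now rewrite !Hf.
Qed.

Lemma periodic_differentiable_bounded : forall T f, 0 < T -> periodic T f ->
  (forall x, ex_derive f x) -> exists K, 0 <= K /\ forall x, Rabs (f x) <= K.
Proof.
  intros T f HT Hf Hd.
  destruct (continuity_ab_maj (fun x => Rabs (f x)) 0 T) as [x0 [Hmax _]]; [lra| |].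
  - intros c _. apply continuity_pt_filterlim.
    apply (continuous_comp f Rabs).
    + now apply (ex_derive_continuous (V := R_NormedModule)).
    + apply continuous_Rabs.
  - exists (Rabs (f x0)). split; [apply Rabs_pos|]. intros x.
    destruct (periodic_representative T x HT) as [y [Hy Hxy]].
    rewrite (Hxy f Hf). now apply Hmax.
Qed.

(** On one period the Hölder condition compares [f''] with [f'' 0] up to the
    constant, as distances there are at most one. *)
Lemma holder_class_2_bounded : forall alpha f,
  0 < alpha -> holder_class 2 alpha f -> periodic 1 f ->
  (forall x, ex_derive f x) /\ (forall x, ex_derive (Derive f) x) /\
  exists K, 0 <= K /\ forall x, Rabs (Derive (Derive f) x) <= K.
Proof.
  intros alpha f Halpha [Hex [K HK]] Hper. repeat split.
  - intros x. exact (Hex 1%nat x (le_S _ _ (le_n _))).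
  - intros x. exact (Hex 2%nat x (le_n _)).
  - exists (Rabs (Derive (Derive f) 0) + Rabs K). split.
    { apply Rplus_le_le_0_compat; apply Rabs_pos. }
    intros x. destruct (periodic_representative 1 x Rlt_0_1) as [y [Hy Hxy]].
    rewrite (Hxy _ (periodic_Derive _ _ (periodic_Derive _ _ Hper))).
    specialize (HK y 0). change (Derive_n f 2) with (Derive (Derive f)) in HK.
    rewrite Rminus_0_r, (Rabs_right y) in HK by lra.
    assert (Hpow : 0 < Rpower y alpha <= 1).
    { split; [apply exp_pos|]. unfold Rpower. rewrite <- exp_0.
      apply Rnot_lt_le. intros Hlt. apply exp_lt_inv in Hlt.
      apply Rlt_not_le with (1 := Hlt).
      destruct (Req_dec y 0) as [->|Hy0].
      - unfold ln. destruct Rlt_dec as [Habs|_]; [destruct (Rlt_irrefl _ Habs)|lra].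
      - assert (ln y <= 0) by (rewrite <- ln_1; apply ln_le; lra). nra. }
    assert (HK' : K * Rpower y alpha <= Rabs K).
    { apply Rle_trans with (Rabs K * Rpower y alpha).
      - apply Rmult_le_compat_r; [lra|apply Rle_abs].
      - pose proof (Rabs_pos K). nra. }
    pose proof (Rabs_triang (Derive (Derive f) y - Derive (Derive f) 0)
                  (Derive (Derive f) 0)) as Htri.
    replace (Derive (Derive f) y - Derive (Derive f) 0 + Derive (Derive f) 0)
      with (Derive (Derive f) y) in Htri by ring.
    lra.
Qed.

Lemma derive_zero_constant : forall f,
  (forall x, is_derive f x 0) -> forall x y, f x = f y.
Proof.
  intros f Hf x y. destruct (MVT_gen f x y (fun _ => 0)) as [c [_ Hc]].
  - intros z _. apply Hf.
  - intros z _. apply continuity_pt_filterlim, (ex_derive_continuous (V := R_NormedModule)).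
    eexists; apply Hf.
  - lra.
Qed.

(** The number [m] is the mean of [a'^2].  It is positive because the primitive
    [I] of [a'^2] is monotone and gains [m] over each period: for [m <= 0] it
    would be constant, forcing [a' = 0]. *)
Lemma primitive_of_centred_square : forall a, periodic 1 a ->
  (forall x, ex_derive a x) -> (forall x, ex_derive (Derive a) x) ->
  ~ is_constant a ->
  exists m E, 0 < m /\ periodic 1 E /\
    forall s, is_derive E s (Derive a s ^ 2 - m).
Proof.
  intros a Hper Ha Ha2 Hnc.
  assert (Hcont : forall x, continuous (fun u => Derive a u ^ 2) x).
  { intros x. apply (ex_derive_continuous (V := R_NormedModule)). auto_derive. apply Ha2. }
  set (I := fun s : R => RInt (fun u => Derive a u ^ 2) 0 s).
  assert (HI : forall s, is_derive I s (Derive a s ^ 2)).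
  { intros s. apply (is_derive_RInt (V := R_NormedModule) (fun u => Derive a u ^ 2) I 0 s); trivial.
    apply filter_forall. intros x.
      apply (RInt_correct (V := R_CompleteNormedModule)).
      apply (ex_RInt_continuous (V := R_CompleteNormedModule)). auto. }
  assert (HI0 : I 0 = 0) by apply (RInt_point (V := R_CompleteNormedModule)).
  assert (Hper' := periodic_Derive 1 a Hper).
  assert (Hshift : forall s, I (s + 1) = I s + I 1).
  { intros s.
    assert (H := derive_zero_constant (fun x => I (x + 1) - I x)).
    cut (I (s + 1) - I s = I (0 + 1) - I 0); [rewrite HI0, Rplus_0_l; lra|].
    apply H. intros x. evar_last.
    - apply (is_derive_minus (V := R_NormedModule)); [|apply HI].
      apply (is_derive_comp (V := R_NormedModule) I (fun x => x + 1)); [apply HI|].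
      auto_derive; trivial.
    - rewrite Hper'. unfold minus, plus, opp, scal; simpl; unfold mult; simpl. ring. }
  assert (Hmono : forall x y, x <= y -> I x <= I y).
  { intros x y Hxy. destruct (MVT_gen I x y (fun u => Derive a u ^ 2)) as [c [_ Hc]].
    - intros z _. apply HI.
    - intros z _. apply continuity_pt_filterlim, (ex_derive_continuous (V := R_NormedModule)).
      eexists; apply HI.
    - pose proof (pow2_ge_0 (Derive a c)). nra. }
  exists (I 1), (fun s => I s - I 1 * s). split; [|split].
  - apply Rnot_le_lt. intros Hm. apply Hnc.
    assert (Hconst : forall x, I x = I 0).
    { intros x. destruct (periodic_representative 1 x Rlt_0_1) as [y [Hy Hxy]].
      pose proof (Hmono 0 1 ltac:(lra)).
      rewrite (Hxy I) by (intros s; rewrite Hshift; lra).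
      pose proof (Hmono 0 y ltac:(lra)). pose proof (Hmono y 1 ltac:(lra)). lra. }
    assert (Hz : forall x, Derive a x = 0).
    { intros x. assert (Hx := is_derive_unique _ _ _ (HI x)).
      rewrite (Derive_ext I (fun _ => I 0)), Derive_const in Hx by apply Hconst.
      nra. }
    exists (a 0). intros t. apply derive_zero_constant. intros x.
    rewrite <- (Hz x). now apply Derive_correct.
  - intros s. rewrite Hshift. ring.
  - intros s. evar_last.
    + apply (is_derive_minus (V := R_NormedModule)); [apply HI|].
      auto_derive; [trivial|reflexivity].
    + unfold minus, plus, opp; simpl. ring.
Qed.

(** * Maxima on a strip and conditions at a minimum *)

Lemma continuity_2d_comp : forall f g h x y,
  continuity_2d_pt f (g x y) (h x y) ->
  continuity_2d_pt g x y -> continuity_2d_pt h x y ->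
  continuity_2d_pt (fun u v => f (g u v) (h u v)) x y.
Proof.
  intros f g h x y Hf Hg Hh eps.
  destruct (Hf eps) as [d Hd].
  destruct (locally_2d_and _ _ _ _ (Hg d) (Hh d)) as [d' Hd'].
  exists d'. intros u v Hu Hv. destruct (Hd' u v Hu Hv). now apply Hd.
Qed.

(** Maxima in the space variable depend continuously on time by uniform
    continuity, so a one-dimensional extreme value theorem over one period
    suffices. *)
Lemma periodic_strip_max : forall (f : R -> R -> R) lo hi T,
  lo <= hi -> 0 < T ->
  (forall x t, lo <= x <= hi -> continuity_2d_pt f x t) ->
  (forall x, lo <= x <= hi -> periodic T (f x)) ->
  exists x0 t0, lo <= x0 <= hi /\
    forall x t, lo <= x <= hi -> f x t <= f x0 t0.
Proof.
  intros f lo hi T Hlh HT Hc Hp.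
  assert (Hslice : forall t, exists x0, lo <= x0 <= hi /\
             forall x, lo <= x <= hi -> f x t <= f x0 t).
  { intros t. destruct (continuity_ab_maj (fun x => f x t) lo hi) as [x0 [H1 H2]]; trivial.
    - intros x Hx eps Heps. destruct (Hc x t Hx (mkposreal eps Heps)) as [d Hd].
      exists d. split; [apply cond_pos|]. intros u [_ Hu]. simpl in *.
      unfold R_dist in *. apply Hd; trivial. rewrite Rminus_diag, Rabs_R0. apply cond_pos.
    - exists x0. split; trivial. }
  set (m := fun t => proj1_sig (constructive_indefinite_description _ (Hslice t))).
  assert (Hm : forall t, lo <= m t <= hi /\
             forall x, lo <= x <= hi -> f x t <= f (m t) t)
    by (intros t; apply proj2_sig).
  destruct (continuity_ab_maj (fun t => f (m t) t) 0 T) as [t0 [Hmax _]]; [lra| |].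
  - intros t Ht eps Heps.
    assert (He2 : 0 < eps / 2) by lra.
    destruct (uniform_continuity_2d f lo hi (t - 1) (t + 1)
                (fun x y Hx _ => Hc x y Hx) (mkposreal _ He2)) as [d Hd].
    exists (Rmin d 1). split; [apply Rmin_pos; [apply cond_pos|lra]|].
    intros s [_ Hs]. simpl in *. unfold R_dist in *.
    pose proof (Rmin_l d 1). pose proof (Rmin_r d 1).
    assert (Hts : t - 1 <= s <= t + 1) by (apply Rabs_def2 in Hs; lra).
    assert (Hu : forall x, lo <= x <= hi -> Rabs (f x s - f x t) < eps / 2).
    { intros x Hx. apply Hd; try lra. rewrite Rminus_diag, Rabs_R0. apply cond_pos. }
    destruct (Hm s) as [Hs1 Hs2]. destruct (Hm t) as [Ht1 Ht2].
    pose proof (Rabs_def2 _ _ (Hu _ Hs1)). pose proof (Rabs_def2 _ _ (Hu _ Ht1)).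
    specialize (Hs2 _ Ht1). specialize (Ht2 _ Hs1).
    apply Rabs_def1; lra.
  - exists (m t0), t0. destruct (Hm t0) as [H1 H2]. split; trivial.
    intros x t Hx. destruct (periodic_representative T t HT) as [s [Hs Hts]].
    rewrite (Hts _ (Hp x Hx)). apply Rle_trans with (f (m s) s).
    + now apply Hm.
    + now apply Hmax.
Qed.

Lemma local_min_derive : forall f x,
  locally x (fun z => f x <= f z) -> ex_derive f x -> Derive f x = 0.
Proof.
  intros f x [d Hd] [l Hl]. rewrite (is_derive_unique _ _ _ Hl).
  apply is_derive_Reals in Hl.
  set (pr := exist _ l Hl : derivable_pt f x).
  change l with (derive_pt f x pr).
  apply (deriv_minimum f (x - d) (x + d)); try (pose proof (cond_pos d); lra).
  intros z Hz1 Hz2. apply Hd. apply Rabs_def1; unfold minus, plus, opp; simpl; lra.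
Qed.

(** The second derivative is only assumed to exist at [x] itself: if it were
    negative, [f'] would be negative just to the right of its zero [x], and the
    mean value theorem would push [f] below [f x] there. *)
Lemma local_min_second_derive : forall f x,
  locally x (fun z => f x <= f z /\ ex_derive f z) -> ex_derive (Derive f) x ->
  0 <= Derive (Derive f) x.
Proof.
  intros f x Hloc Hd2. apply Rnot_lt_le. intros Hneg.
  assert (H0 : Derive f x = 0).
  { apply local_min_derive.
    - apply filter_imp with (2 := Hloc). now intros z [Hz _].
    - now destruct (locally_singleton _ _ Hloc). }
  apply Derive_correct in Hd2. apply is_derive_Reals in Hd2.
  destruct (Hd2 (- Derive (Derive f) x)) as [d1 Hd1]; [lra|].
  destruct Hloc as [d2 Hd2'].
  set (h := Rmin d1 d2 / 2).
  pose proof (cond_pos d1). pose proof (cond_pos d2).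
  pose proof (Rmin_l d1 d2). pose proof (Rmin_r d1 d2).
  assert (Hh : 0 < Rmin d1 d2) by (now apply Rmin_pos).
  assert (Hnear : forall z, x <= z <= x + h -> f x <= f z /\ ex_derive f z).
  { intros z Hz. apply Hd2'.
    apply Rabs_def1; unfold minus, plus, opp; simpl; unfold h in *; lra. }
  destruct (MVT_cor2 f (Derive f) x (x + h)) as [c [Hmvt Hc]].
  - unfold h; lra.
  - intros z Hz. apply is_derive_Reals, Derive_correct. now apply Hnear.
  - destruct (Hnear (x + h)) as [Hmin _]; [unfold h; lra|].
    assert (Hq : Rabs ((Derive f (x + (c - x)) - Derive f x) / (c - x)
                       - Derive (Derive f) x) < - Derive (Derive f) x).
    { apply Hd1; [lra|]. rewrite Rabs_right; unfold h in *; lra. }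
    apply Rabs_def2 in Hq. replace (x + (c - x)) with c in Hq by ring.
    rewrite H0, Rminus_0_r in Hq.
    assert (Hneg' : Derive f c / (c - x) < 0) by lra.
    assert (Heq : Derive f c = Derive f c / (c - x) * (c - x)) by (field; lra).
    assert (Hh2 : 0 < h) by (unfold h; lra).
    assert (Derive f c < 0) by (rewrite Heq; nra).
    nra.
Qed.

(** An eigenfunction is only known to be continuous on the closed strip, and
    relative to it.  Freezing it outside the strip at its boundary values gives
    a function continuous on the whole plane. *)
Definition clamp (lo hi x : R) : R := Rmax lo (Rmin x hi).

Lemma clamp_range : forall lo hi x, lo <= hi -> lo <= clamp lo hi x <= hi.
Proof.
  intros lo hi x H. unfold clamp. split; [apply Rmax_l|].
  apply Rmax_lub; trivial. apply Rmin_r.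
Qed.

Lemma clamp_id : forall lo hi x, lo <= x <= hi -> clamp lo hi x = x.
Proof.
  intros lo hi x H. unfold clamp. rewrite Rmin_left, Rmax_right; lra.
Qed.

Lemma clamp_lipschitz : forall lo hi x y,
  Rabs (clamp lo hi x - clamp lo hi y) <= Rabs (x - y).
Proof.
  intros lo hi x y. unfold clamp, Rmax, Rmin.
  repeat (destruct Rle_dec); apply Rabs_le_between';
    pose proof (Rle_abs (x - y)); pose proof (Rle_abs (- (x - y)));
    rewrite Rabs_Ropp in *; lra.
Qed.

Lemma clamped_continuous : forall (f : R -> R -> R) lo hi x t, lo <= hi ->
  continuous_on (fun p : R * R => lo <= fst p <= hi)
    (fun p : R * R => f (fst p) (snd p)) ->
  continuity_2d_pt (fun u v => f (clamp lo hi u) v) x t.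
Proof.
  intros f lo hi x t Hlh Hf eps.
  pose proof (Hf (clamp lo hi x, t) (clamp_range lo hi x Hlh)) as Hlim.
  destruct (proj1 (filterlim_locally _ _) Hlim eps) as [d Hd].
  exists d. intros u v Hu Hv.
  apply (Hd (clamp lo hi u, v)).
  - split; [|exact Hv].
    apply Rle_lt_trans with (2 := Hu). apply clamp_lipschitz.
  - now apply clamp_range.
Qed.

Lemma ex_derive_continuity_2d : forall (f : R -> R) x t,
  ex_derive f t -> continuity_2d_pt (fun _ v => f v) x t.
Proof.
  intros f x t Hf. apply (continuity_1d_2d_pt_comp f (fun _ v => v)).
  - apply continuity_pt_filterlim. now apply (ex_derive_continuous (V := R_NormedModule)).
  - apply continuity_2d_pt_id2.
Qed.

(** * The parabolic operator and its test functions *)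

Definition parabolic_op (D L0 : R) (A L : R -> R) (u : R -> R -> R) (xi t : R) : R :=
  Derive (fun s => u xi s) t
  - D * (L0 ^ 2 / L t ^ 2) * Derive_n (fun z => u z t) 2 xi
  - (Derive A t * L0 + xi * Derive L t) / L t * Derive (fun z => u z t) xi.

(** Exactly what the derivative tests at a minimum in [t] and in [xi] ask for. *)
Definition parabolic_smooth (u : R -> R -> R) (xi t : R) : Prop :=
  ex_derive (fun s => u xi s) t /\
  locally xi (fun z => ex_derive (fun y => u y t) z) /\
  ex_derive_n (fun z => u z t) 2 xi.

(** The parabolic maximum principle at a point of contact: [v - u] has a
    minimum there in each variable, so the first derivatives agree, while
    [v] is at least as convex as [u] in space, which lowers the operator. *)
Lemma parabolic_op_touching : forall D L0 A L u v xi t,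
  0 < D -> L t <> 0 ->
  parabolic_smooth u xi t -> parabolic_smooth v xi t ->
  locally t (fun s => u xi s <= v xi s) ->
  locally xi (fun z => u z t <= v z t) ->
  u xi t = v xi t ->
  parabolic_op D L0 A L v xi t <= parabolic_op D L0 A L u xi t.
Proof.
  intros D L0 A L u v xi t HD HL [Hut [Hux Huxx]] [Hvt [Hvx Hvxx]] Ht Hx Heq.
  pose proof (locally_singleton _ _ Hux) as Hux0.
  pose proof (locally_singleton _ _ Hvx) as Hvx0. simpl in Hux0, Hvx0.
  assert (E1 : Derive (fun s => v xi s - u xi s) t = 0).
  { apply local_min_derive.
    - apply filter_imp with (2 := Ht). intros s Hs. lra.
    - now apply (ex_derive_minus (V := R_NormedModule)). }
  assert (E2 : Derive (fun z => v z t - u z t) xi = 0).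
  { apply local_min_derive.
    - apply filter_imp with (2 := Hx). intros s Hs. lra.
    - now apply (ex_derive_minus (V := R_NormedModule)). }
  assert (Hext : locally xi (fun z =>
            Derive (fun z => v z t) z - Derive (fun z => u z t) z
            = Derive (fun z => v z t - u z t) z)).
  { apply filter_imp with (2 := filter_and _ _ Hux Hvx). intros z [H1 H2].
    symmetry. now apply Derive_minus. }
  assert (E3 : 0 <= Derive (Derive (fun z => v z t - u z t)) xi).
  { apply local_min_second_derive.
    - apply filter_imp with (2 := filter_and _ _ Hx (filter_and _ _ Hux Hvx)).
      intros z [H0 [H1 H2]]. split; [lra|].
      now apply (ex_derive_minus (V := R_NormedModule)).
    - apply (ex_derive_ext_loc _ _ _ Hext).
      now apply (ex_derive_minus (V := R_NormedModule)). }
  rewrite <- (Derive_ext_loc _ _ _ Hext) in E3.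
  rewrite (Derive_minus (Derive (fun z => v z t)) (Derive (fun z => u z t))) in E3
    by assumption.
  rewrite Derive_minus in E1, E2 by assumption.
  apply Rminus_diag_uniq in E1, E2. apply Rminus_le_0 in E3.
  assert (F1 : Derive (fun s => v xi s) t = Derive (fun s => u xi s) t) by exact E1.
  unfold parabolic_op. rewrite F1, E2.
  assert (0 <= D * (L0 ^ 2 / L t ^ 2)).
  { apply Rmult_le_pos; [lra|]. apply Rdiv_le_0_compat; [apply pow2_ge_0|].
    apply pow2_gt_0; trivial. }
  assert (D * (L0 ^ 2 / L t ^ 2) * Derive_n (fun z => u z t) 2 xi
          <= D * (L0 ^ 2 / L t ^ 2) * Derive_n (fun z => v z t) 2 xi)
    by (apply Rmult_le_compat_l; trivial).
  lra.
Qed.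

Lemma eigenfunction_smooth : forall D L0 T A L mu phi xi t,
  principal_eigenfunction D L0 T A L mu phi -> 0 < xi < L0 ->
  parabolic_smooth phi xi t.
Proof.
  intros D L0 T A L mu phi xi t [[_ Hreg] _] Hxi.
  destruct (Hreg xi t Hxi) as [H1 [_ [H2 _]]]. repeat split; trivial.
  assert (Hopen : locally xi (fun z => 0 < z < L0)).
  { apply (open_and _ _ (open_gt 0) (open_lt L0)). trivial. }
  apply filter_imp with (2 := Hopen). intros z Hz. exact (proj1 (proj2 (Hreg z t Hz))).
Qed.

(** In the fixed coordinate [x = A + xi L / L0] this is
    [G (al(t) x + be(t))].  All barriers used below have this form: plane waves
    [exp (al(t) x + be(t))] and travelling bumps [G (x - x0(t))]. *)
Definition ridge (L0 : R) (A L al be G : R -> R) (xi t : R) : R :=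
  G (al t * (A t + xi * (L t / L0)) + be t).

(** The change of variables turns the operator back into [u_t - D u_xx], so the
    motion of the domain disappears and only that of the phase
    [al(t) x + be(t)] remains. *)
Lemma ridge_heat : forall D L0 (A L al be G G1 G2 : R -> R) (xi t : R),
  L0 <> 0 -> L t <> 0 ->
  ex_derive A t -> ex_derive L t -> ex_derive al t -> ex_derive be t ->
  (forall z, is_derive G z (G1 z)) -> (forall z, is_derive G1 z (G2 z)) ->
  parabolic_smooth (ridge L0 A L al be G) xi t /\
  parabolic_op D L0 A L (ridge L0 A L al be G) xi t =
    ridge L0 A L al be G1 xi t
      * (Derive al t * (A t + xi * (L t / L0)) + Derive be t)
    - D * al t ^ 2 * ridge L0 A L al be G2 xi t.
Proof.
  intros D L0 A L al be G G1 G2 xi t HL0 HL HA HdL Hal Hbe HG HG1.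
  assert (Ht : is_derive (fun s => ridge L0 A L al be G xi s) t
    (G1 (al t * (A t + xi * (L t / L0)) + be t)
     * (Derive al t * (A t + xi * (L t / L0))
        + al t * (Derive A t + xi * (Derive L t / L0)) + Derive be t))).
  { unfold ridge. evar_last.
    - apply (is_derive_comp G); [apply HG|]. auto_derive; [|reflexivity]. tauto.
    - unfold scal; simpl; unfold mult; simpl. rewrite Rmult_comm. f_equal.
      change (fun x : R => A x) with A. change (fun x : R => L x) with L.
      change (fun x : R => al x) with al. change (fun x : R => be x) with be.
      field; trivial. }
  assert (Hx : forall z, is_derive (fun y => ridge L0 A L al be G y t) z
    (al t * (L t / L0) * ridge L0 A L al be G1 z t)).
  { intros z. unfold ridge. evar_last.
    - apply (is_derive_comp G); [apply HG|]. auto_derive; [|reflexivity]. trivial.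
    - unfold scal; simpl; unfold mult; simpl. field; trivial. }
  assert (Hxx : forall z, is_derive (Derive (fun y => ridge L0 A L al be G y t)) z
    ((al t * (L t / L0)) ^ 2 * ridge L0 A L al be G2 z t)).
  { intros z. apply is_derive_ext with
      (fun z => al t * (L t / L0) * ridge L0 A L al be G1 z t).
    - intros y. symmetry. apply is_derive_unique, Hx.
    - unfold ridge. evar_last.
      + apply is_derive_scal.
        apply (is_derive_comp G1); [apply HG1|]. auto_derive; [|reflexivity]. trivial.
      + unfold scal; simpl; unfold mult; simpl. field; trivial. }
  split.
  - repeat split.
    + eexists; apply Ht.
    + apply filter_forall. intros z. eexists; apply Hx.
    + eexists; apply Hxx.
  - apply is_derive_unique in Ht.
    pose proof (is_derive_unique _ _ _ (Hx xi)) as Hx'.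
    pose proof (is_derive_unique _ _ _ (Hxx xi)) as Hxx'.
    unfold parabolic_op. etransitivity.
    { apply (f_equal2 Rminus); [apply (f_equal2 Rminus); [exact Ht|]|];
        apply Rmult_eq_compat_l; [exact Hxx'|exact Hx']. }
    unfold ridge. field. split; trivial.
Qed.

Lemma ridge_continuous : forall L0 (A L al be G : R -> R) xi t,
  ex_derive A t -> ex_derive L t -> ex_derive al t -> ex_derive be t ->
  (forall z, ex_derive G z) ->
  continuity_2d_pt (ridge L0 A L al be G) xi t.
Proof.
  intros L0 A L al be G xi t HA HL Hal Hbe HG. unfold ridge.
  apply continuity_1d_2d_pt_comp.
  - apply continuity_pt_filterlim. now apply (ex_derive_continuous (V := R_NormedModule)).
  - repeat first
      [ now apply ex_derive_continuity_2d | apply continuity_2d_pt_id1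
      | apply continuity_2d_pt_const | apply continuity_2d_pt_mult
      | apply continuity_2d_pt_plus ].
Qed.

(** * Comparison with the eigenfunction *)

(** Comparison from above: under the last hypothesis the plane wave
    [w = exp (al x + be)] satisfies [w_t - D w_xx >= lam w] and is bounded below
    on the closed domain.  Hence [phi / w] attains its maximum [c], at an
    interior point because [phi] vanishes on the boundary, and there
    [c w] touches [phi] from above: [lam c w <= mu phi = mu c w]. *)
Lemma eigenvalue_ge : forall D L0 T (A L al be : R -> R) mu lam,
  0 < D -> 0 < L0 -> 0 < T -> (forall t, 0 < L t) ->
  periodic T A -> periodic T L -> periodic T al -> periodic T be ->
  (forall t, ex_derive A t) -> (forall t, ex_derive L t) ->
  (forall t, ex_derive al t) -> (forall t, ex_derive be t) ->
  principal_periodic_eigenvalue D L0 T A L mu ->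
  (forall x t, A t <= x <= A t + L t ->
     lam <= Derive al t * x + Derive be t - D * al t ^ 2) ->
  lam <= mu.
Proof.
  intros D L0 T A L al be mu lam HD HL0 HT HL HpA HpL Hpal Hpbe HA HdL Hal Hbe
    [phi Hphi] Hineq.
  pose proof Hphi as [[Hcont _] [Hpos [Hbdry [Hper Heq]]]].
  assert (Hcl : forall x, 0 <= x <= L0 -> clamp 0 L0 x = x) by (apply clamp_id).
  set (w := ridge L0 A L al be exp).
  assert (Hw : forall x t, 0 < w x t) by (intros; apply exp_pos).
  destruct (periodic_strip_max (fun x t => phi (clamp 0 L0 x) t * / w x t) 0 L0 T)
    as [xi [t [Hxi Hmax]]]; try lra.
  - intros x t _. apply continuity_2d_pt_mult.
    + apply clamped_continuous; [lra|exact Hcont].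
    + apply continuity_2d_pt_inv.
      * apply ridge_continuous; trivial. intros z; auto_derive; trivial.
      * apply Rgt_not_eq, Hw.
  - intros x Hx t. rewrite Hcl by trivial. rewrite (Hper x Hx).
    unfold w, ridge. now rewrite HpA, HpL, Hpal, Hpbe.
  - set (c := phi (clamp 0 L0 xi) t * / w xi t) in Hmax.
    assert (Hc : 0 < c).
    { apply Rlt_le_trans with (phi (clamp 0 L0 (L0 / 2)) t * / w (L0 / 2) t).
      - rewrite Hcl by lra. apply Rmult_lt_0_compat.
        + apply Hpos; lra.
        + apply Rinv_0_lt_compat, Hw.
      - apply Hmax. lra. }
    assert (Htouch : phi xi t = c * w xi t).
    { unfold c. rewrite Hcl by trivial. field. apply Rgt_not_eq, Hw. }
    assert (Hle : forall x s, 0 <= x <= L0 -> phi x s <= c * w x s).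
    { intros x s Hx. specialize (Hmax x s Hx). rewrite Hcl in Hmax by trivial.
      apply Rmult_le_compat_r with (r := w x s) in Hmax; [|apply Rlt_le, Hw].
      rewrite Rmult_assoc, Rinv_l in Hmax by (apply Rgt_not_eq, Hw). lra. }
    assert (Hint : 0 < xi < L0).
    { pose proof (Hw xi t). destruct (Hbdry t) as [H0 H1].
      split; apply Rnot_le_lt; intros Hn.
      - replace xi with 0 in * by lra. nra.
      - replace xi with L0 in * by lra. nra. }
    destruct (ridge_heat D L0 A L al be (fun z => c * exp z) (fun z => c * exp z)
                (fun z => c * exp z) xi t) as [Hsm Hop]; trivial;
      try lra; try (intros z; auto_derive; trivial; ring);
      [apply Rgt_not_eq, HL|].
    assert (Hcmp : parabolic_op D L0 A L (ridge L0 A L al be (fun z => c * exp z)) xi t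
                   <= parabolic_op D L0 A L phi xi t).
    { apply parabolic_op_touching; trivial.
      - apply Rgt_not_eq, HL.
      - now apply eigenfunction_smooth with (1 := Hphi).
      - apply filter_forall. intros s. now apply Hle.
      - apply filter_imp with (fun z => 0 < z < L0).
        + intros z Hz. apply Hle. lra.
        + apply (open_and _ _ (open_gt 0) (open_lt L0)). trivial. }
    rewrite Hop in Hcmp. unfold parabolic_op in Hcmp. rewrite Heq in Hcmp by trivial.
    rewrite Htouch in Hcmp. unfold ridge in Hcmp. fold (ridge L0 A L al be exp xi t) in Hcmp.
    fold w in Hcmp.
    assert (Hx : A t <= A t + xi * (L t / L0) <= A t + L t).
    { specialize (HL t). assert (0 < L t / L0) by (now apply Rdiv_lt_0_compat).
      assert (L0 * (L t / L0) = L t) by (field; lra). nra. }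
    specialize (Hineq _ _ Hx). pose proof (Hw xi t).
    apply Rmult_le_reg_r with (c * w xi t); [nra|].
    apply Rle_trans with (2 := Hcmp).
    apply Rmult_le_compat_r with (r := c * w xi t) in Hineq; nra.
Qed.

(** Comparison from below, with a bump [q^2], [q = r^2 - y^2],
    [y = x - x0(t)], that follows an interval staying strictly inside the
    domain.  There [phi] is positive, so [q^2 / phi] attains its maximum [c],
    necessarily where [q > 0], and [q^2 / c] touches [phi] from below.  With
    [V] a bound on the speed of [x0],
    [(q^2)_t - D (q^2)_xx <= 4 (r V + 3 D) q - 8 D r^2], and the inequality
    [2 X Y <= X^2 + Y^2] bounds this by a multiple of [q^2].  The bump has to be
    squared: at the edge of the support [-D (q^2)_xx] is negative, whereas
    [-D q_xx = 2 D] is positive and no multiple of [q] controls it there. *)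
Lemma eigenvalue_le : forall D L0 T (A L x0 : R -> R) mu r V,
  0 < D -> 0 < L0 -> 0 < T -> 0 < r -> (forall t, 0 < L t) ->
  periodic T A -> periodic T L -> periodic T x0 ->
  (forall t, ex_derive A t) -> (forall t, ex_derive L t) ->
  (forall t, ex_derive x0 t) ->
  principal_periodic_eigenvalue D L0 T A L mu ->
  (forall t, A t < x0 t - r /\ x0 t + r < A t + L t) ->
  (forall t, Rabs (Derive x0 t) <= V) ->
  mu <= (r * V + 3 * D) ^ 2 / (2 * D * r ^ 2).
Proof.
  intros D L0 T A L x0 mu r V HD HL0 HT Hr HL HpA HpL Hpx HA HdL Hx0
    [phi Hphi] Hin HV.
  pose proof Hphi as [[Hcont _] [Hpos [Hbdry [Hper Heq]]]].
  set (Xi := fun y t => (x0 t + y - A t) * L0 / L t).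
  assert (HXi : forall y t, - r <= y <= r -> 0 < Xi y t < L0).
  { intros y t Hy. unfold Xi. destruct (Hin t) as [H1 H2]. specialize (HL t). split.
    - apply Rdiv_lt_0_compat; trivial. apply Rmult_lt_0_compat; lra.
    - apply Rlt_div_l; trivial. rewrite (Rmult_comm L0). apply Rmult_lt_compat_r; lra. }
  destruct (periodic_strip_max
     (fun y t => (r ^ 2 - y ^ 2) ^ 2 * / phi (clamp 0 L0 (Xi y t)) t) (- r) r T)
    as [y [t [Hy Hmax]]]; try lra.
  - intros y t Hy. apply continuity_2d_pt_mult.
    + apply (continuity_1d_2d_pt_comp (fun y => (r ^ 2 - y ^ 2) ^ 2) (fun u _ => u)).
      * apply continuity_pt_filterlim, (ex_derive_continuous (V := R_NormedModule)).
        auto_derive; trivial.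
      * apply continuity_2d_pt_id1.
    + apply continuity_2d_pt_inv.
      * apply (continuity_2d_comp (fun u v => phi (clamp 0 L0 u) v) Xi (fun _ v => v)).
        -- apply clamped_continuous; [lra|exact Hcont].
        -- unfold Xi, Rdiv, Rminus.
           assert (HLt := HL t).
           repeat first
            [ now apply ex_derive_continuity_2d | apply continuity_2d_pt_id1
            | apply continuity_2d_pt_const | apply continuity_2d_pt_mult
            | apply continuity_2d_pt_plus | apply continuity_2d_pt_opp
            | apply continuity_2d_pt_inv | lra ].
        -- apply continuity_2d_pt_id2.
      * specialize (HXi y t Hy). rewrite clamp_id by lra.
        apply Rgt_not_eq, Hpos. trivial.
  - intros y Hy t. assert (E : Xi y (t + T) = Xi y t) by (unfold Xi; now rewrite HpA, HpL, Hpx).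
    rewrite E. f_equal. f_equal. apply Hper. apply clamp_range. lra.
  - assert (Hcl : forall y t, - r <= y <= r -> clamp 0 L0 (Xi y t) = Xi y t).
    { intros z s Hz. specialize (HXi z s Hz). apply clamp_id. lra. }
    cbv beta in Hmax. rewrite Hcl in Hmax by trivial.
    set (c := (r ^ 2 - y ^ 2) ^ 2 * / phi (Xi y t) t) in Hmax.
    assert (Hphipos : forall z s, - r <= z <= r -> 0 < phi (Xi z s) s).
    { intros z s Hz. now apply Hpos, HXi. }
    assert (Hc : 0 < c).
    { apply Rlt_le_trans with ((r ^ 2 - 0 ^ 2) ^ 2 * / phi (clamp 0 L0 (Xi 0 0)) 0).
      - rewrite Hcl by lra. apply Rmult_lt_0_compat.
        + assert (0 < r ^ 2) by (apply pow_lt; lra). apply pow_lt. lra.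
        + apply Rinv_0_lt_compat, Hphipos. lra.
      - apply Hmax. lra. }
    set (xi := Xi y t) in *.
    assert (Hxi : 0 < xi < L0) by (now apply HXi).
    assert (Htouch : (r ^ 2 - y ^ 2) ^ 2 / c = phi xi t).
    { pose proof (Hphipos y t Hy) as Hp. fold xi in Hp.
      apply Rmult_eq_reg_r with c; [|lra].
      transitivity ((r ^ 2 - y ^ 2) ^ 2); [field; lra|].
      unfold c. field. lra. }
    assert (Hle : forall z s, - r <= z <= r -> (r ^ 2 - z ^ 2) ^ 2 / c <= phi (Xi z s) s).
    { intros z s Hz. specialize (Hmax z s Hz). rewrite Hcl in Hmax by trivial.
      pose proof (Hphipos z s Hz). apply Rle_div_l; trivial.
      apply (Rle_div_l _ c) in Hmax; trivial. lra. }
    assert (Hyint : - r < y < r).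
    { pose proof (Hphipos y t Hy) as Hp. fold xi in Hp.
      split; apply Rnot_le_lt; intros Hn.
      - replace y with (- r) in Htouch by lra.
        replace ((r ^ 2 - (- r) ^ 2) ^ 2 / c) with 0 in Htouch by (field; lra). lra.
      - replace y with r in Htouch by lra.
        replace ((r ^ 2 - r ^ 2) ^ 2 / c) with 0 in Htouch by (field; lra). lra. }
    (* The inverse of [Xi] at each time: the position relative to [x0]. *)
    set (Y := fun z s => 1 * (A s + z * (L s / L0)) + - x0 s).
    assert (HXY : forall z s, Xi (Y z s) s = z).
    { intros z s. unfold Xi, Y. specialize (HL s). field. lra. }
    assert (HYX : Y xi t = y).
    { unfold xi, Xi, Y. specialize (HL t). field. lra. }
    set (G := fun z => (r ^ 2 - z ^ 2) ^ 2 / c).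
    set (G1 := fun z => - 4 * z * (r ^ 2 - z ^ 2) / c).
    set (G2 := fun z => (8 * z ^ 2 - 4 * (r ^ 2 - z ^ 2)) / c).
    destruct (ridge_heat D L0 A L (fun _ => 1) (fun s => - x0 s) G G1 G2 xi t)
      as [Hsm Hop]; trivial; try lra.
    + apply Rgt_not_eq, HL.
    + auto_derive; trivial.
    + auto_derive. trivial.
    + intros z. unfold G, G1. auto_derive; trivial. field. lra.
    + intros z. unfold G1, G2. auto_derive; trivial. field. lra.
    + assert (Hopen : open (fun z => - r < z < r)) by (apply open_and; [apply open_gt|apply open_lt]).
      assert (Hcmp : parabolic_op D L0 A L phi xi t
                     <= parabolic_op D L0 A L (ridge L0 A L (fun _ => 1) (fun s => - x0 s) G) xi t).
      { apply parabolic_op_touching; trivial.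
        - apply Rgt_not_eq, HL.
        - now apply eigenfunction_smooth with (1 := Hphi).
        - assert (Hloc : locally t (fun s => - r < Y xi s < r)).
          { assert (Hct : continuous (fun s => Y xi s) t).
            { apply (ex_derive_continuous (V := R_NormedModule)). unfold Y.
              auto_derive. repeat split; trivial. }
            apply (Hct (fun z => - r < z < r)), (Hopen (Y xi t)). now rewrite HYX. }
          apply filter_imp with (2 := Hloc). intros s Hs.
          pose proof (Hle (Y xi s) s) as H.
          rewrite HXY in H. apply H. lra.
        - assert (Hloc : locally xi (fun z => - r < Y z t < r)).
          { assert (Hct : continuous (fun z => Y z t) xi).
            { apply (ex_derive_continuous (V := R_NormedModule)). unfold Y.
              auto_derive. repeat split; trivial. }
            apply (Hct (fun z => - r < z < r)), (Hopen (Y xi t)). now rewrite HYX. }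
          apply filter_imp with (2 := Hloc). intros z Hz.
          pose proof (Hle (Y z t) t) as H.
          rewrite HXY in H. apply H. lra.
        - change (G (Y xi t) = phi xi t). now rewrite HYX. }
      rewrite Hop in Hcmp. unfold parabolic_op in Hcmp. rewrite Heq in Hcmp by trivial.
      unfold ridge in Hcmp. fold (Y xi t) in Hcmp. rewrite HYX in Hcmp.
      rewrite Derive_const, Derive_opp in Hcmp. rewrite <- Htouch in Hcmp.
      specialize (HV t). set (v := Derive x0 t) in *. clearbody v.
      unfold G1, G2 in Hcmp.
      set (q := r ^ 2 - y ^ 2) in *.
      assert (Hq : 0 < q) by (unfold q; nra).
      assert (Hq2 : 0 < q ^ 2) by (now apply pow_lt).
      assert (Hyv : y * v <= r * V).
      { apply Rle_trans with (Rabs (y * v)); [apply Rle_abs|]. rewrite Rabs_mult.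
        apply Rmult_le_compat; try apply Rabs_pos; trivial. apply Rabs_le; lra. }
      assert (Hmu : mu * q ^ 2 <= 4 * (r * V + 3 * D) * q - 8 * D * r ^ 2).
      { apply Rmult_le_compat_r with (r := c) in Hcmp; [|lra].
        replace (mu * (q ^ 2 / c) * c) with (mu * q ^ 2) in Hcmp by (field; lra).
        match type of Hcmp with _ <= ?E =>
          replace E with (4 * (y * v) * q + D * (4 * q - 8 * y ^ 2)) in Hcmp by (field; lra)
        end.
        replace (y ^ 2) with (r ^ 2 - q) in Hcmp by (unfold q; ring).
        assert (y * v * q <= r * V * q) by (apply Rmult_le_compat_r; lra).
        lra. }
      apply Rmult_le_reg_r with (q ^ 2); trivial.
      apply Rle_trans with (1 := Hmu).
      set (M := r * V + 3 * D).
      apply Rminus_le_0.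
      (* The factor in front of [q ^ 2] makes the difference a perfect square. *)
      replace (M ^ 2 / (2 * D * r ^ 2) * q ^ 2 - (4 * M * q - 8 * D * r ^ 2))
        with ((M * q - 4 * D * r ^ 2) ^ 2 / (2 * D * r ^ 2)) by (field; lra).
      apply Rdiv_le_0_compat; [apply pow2_ge_0|].
      assert (0 < r ^ 2) by (apply pow_lt; lra). apply Rmult_lt_0_compat; lra.
Qed.

(** * High-frequency families *)

Lemma rescale_periodic : forall c w f, 0 < w -> periodic 1 f ->
  periodic (2 * PI / w) (rescale c w f).
Proof.
  intros c w f Hw Hf t. unfold rescale. f_equal. rewrite <- (Hf (w * t / (2 * PI))).
  f_equal. pose proof PI_RGT_0. field. lra.
Qed.

Lemma is_derive_rescale : forall c w f t df, is_derive f (w * t / (2 * PI)) df ->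
  is_derive (rescale c w f) t (c * (w / (2 * PI) * df)).
Proof.
  intros c w f t df Hf. unfold rescale. pose proof PI_RGT_0. evar_last.
  - apply is_derive_scal. apply (is_derive_comp f); [exact Hf|].
    auto_derive; [lra|reflexivity].
  - unfold scal; simpl; unfold mult; simpl. field. lra.
Qed.

Lemma ex_derive_rescale : forall c w f t, (forall s, ex_derive f s) ->
  ex_derive (rescale c w f) t.
Proof.
  intros c w f t Hf. eexists. now apply is_derive_rescale, Derive_correct.
Qed.

Lemma period_pos : forall w, 0 < w -> 0 < 2 * PI / w.
Proof.
  intros w Hw. pose proof PI_RGT_0. apply Rdiv_lt_0_compat; lra.
Qed.

(** The plane wave with [al = be = 0], a constant, is an exact solution with
    [lam = 0]. *)
Lemma family_nonneg : forall (l a : R -> R) (D L0 A0 : R) (mu : R -> R),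
  0 < D -> 0 < L0 -> periodic 1 l -> periodic 1 a ->
  (forall s, ex_derive l s) -> (forall s, ex_derive a s) ->
  (forall s, 0 < l s) -> eigenvalue_family D L0 A0 l a mu ->
  forall w, 0 < w -> 0 <= mu w.
Proof.
  intros l a D L0 A0 mu HD HL0 Hlper Haper Hl Ha Hlpos Hmu w Hw.
  apply (eigenvalue_ge D L0 (2 * PI / w) (rescale A0 w a) (rescale L0 w l)
           (fun _ => 0) (fun _ => 0)).
  - exact HD.
  - exact HL0.
  - exact (period_pos w Hw).
  - intros t. exact (Rmult_lt_0_compat _ _ HL0 (Hlpos _)).
  - exact (rescale_periodic _ _ _ Hw Haper).
  - exact (rescale_periodic _ _ _ Hw Hlper).
  - intros t. reflexivity.
  - intros t. reflexivity.
  - intros t. exact (ex_derive_rescale _ _ _ t Ha).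
  - intros t. exact (ex_derive_rescale _ _ _ t Hl).
  - intros t. apply (ex_derive_const (V := R_NormedModule)).
  - intros t. apply (ex_derive_const (V := R_NormedModule)).
  - exact (Hmu w Hw).
  - intros x t _. rewrite !Derive_const. lra.
Qed.

Lemma family_le : forall (l a : R -> R) (D L0 A0 : R) (mu : R -> R),
  0 < D -> 0 < L0 -> periodic 1 l -> periodic 1 a ->
  (forall s, ex_derive l s) -> (forall s, ex_derive a s) ->
  (forall s, 0 < l s) -> eigenvalue_family D L0 A0 l a mu ->
  forall (x0 : R -> R) r V w,
  periodic 1 x0 -> (forall s, ex_derive x0 s) -> 0 < r ->
  (forall s, Rabs (Derive x0 s) <= V) ->
  (forall s, A0 * a s < x0 s - r /\ x0 s + r < A0 * a s + L0 * l s) ->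
  0 < w ->
  mu w <= (r * (w / (2 * PI) * V) + 3 * D) ^ 2 / (2 * D * r ^ 2).
Proof.
  intros l a D L0 A0 mu HD HL0 Hlper Haper Hl Ha Hlpos Hmu
    x0 r V w Hper Hx0 Hr HV Hin Hw.
  assert (Hw' : 0 < w / (2 * PI)) by (pose proof PI_RGT_0; apply Rdiv_lt_0_compat; lra).
  apply (eigenvalue_le D L0 (2 * PI / w) (rescale A0 w a) (rescale L0 w l)
           (rescale 1 w x0)).
  - exact HD.
  - exact HL0.
  - exact (period_pos w Hw).
  - exact Hr.
  - intros t. exact (Rmult_lt_0_compat _ _ HL0 (Hlpos _)).
  - exact (rescale_periodic _ _ _ Hw Haper).
  - exact (rescale_periodic _ _ _ Hw Hlper).
  - exact (rescale_periodic _ _ _ Hw Hper).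
  - intros t. exact (ex_derive_rescale _ _ _ t Ha).
  - intros t. exact (ex_derive_rescale _ _ _ t Hl).
  - intros t. exact (ex_derive_rescale _ _ _ t Hx0).
  - exact (Hmu w Hw).
  - intros t. unfold rescale. rewrite !Rmult_1_l. apply Hin.
  - intros t. assert (Hd := is_derive_rescale 1 w x0 t _ (Derive_correct _ _ (Hx0 _))).
    rewrite (is_derive_unique _ _ _ Hd), Rmult_1_l, Rabs_mult, Rabs_right by lra.
    apply Rmult_le_compat_l; [lra|apply HV].
Qed.

(** For the plane wave [exp (w (p(s) x + h(s)))], [s = w t / (2 pi)], the
    quantity that [eigenvalue_ge] bounds from below is
    [w^2 / (2 pi) (p' x + h' - 2 pi D p^2)].  At [x = A0 a + y], with
    [0 <= y <= L0 l], averaging over a period removes [h] and leaves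
    [A0 * mean (p' a) - 2 pi D * mean (p^2)] up to the effect of [p' y].  The
    choice [p = - d a'] makes the first term [d A0 m], the second is quadratic
    in [d], and [h] is the periodic function that replaces the remaining
    expression by its mean. *)
Lemma family_ge : forall (l a : R -> R) (D L0 A0 : R) (mu : R -> R),
  0 < D -> 0 < L0 -> periodic 1 l -> periodic 1 a ->
  (forall s, ex_derive l s) -> (forall s, ex_derive a s) ->
  (forall s, 0 < l s) -> eigenvalue_family D L0 A0 l a mu ->
  forall m E K M w,
  (forall s, ex_derive (Derive a) s) -> 0 < m -> periodic 1 E ->
  (forall s, is_derive E s (Derive a s ^ 2 - m)) ->
  (forall s, Rabs (Derive (Derive a) s) <= K) -> (forall s, l s <= M) ->
  L0 * (K * M) < A0 * m -> 0 < w ->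
  (A0 * m - L0 * (K * M)) ^ 2 / (16 * PI ^ 2 * D * m) * w ^ 2 <= mu w.
Proof.
  intros l a D L0 A0 mu HD HL0 Hlper Haper Hl Ha Hlpos Hmu
    m E K M w Ha2 Hm HEper HE HK HM Hgap Hw.
  pose proof PI_RGT_0 as HPI.
  set (g := A0 * m - L0 * (K * M)).
  (* The maximiser of the quadratic [d g - 2 pi D m d^2] that appears below. *)
  set (d := g / (4 * PI * D * m)).
  assert (Hpm : 0 < PI * D * m)
    by (apply Rmult_lt_0_compat; [now apply Rmult_lt_0_compat|exact Hm]).
  assert (Hd : 0 < d) by (unfold d, g; apply Rdiv_lt_0_compat; lra).
  set (h := fun s => 2 * PI * D * d ^ 2 * E s + d * A0 * (Derive a s * a s - E s)).
  assert (Hh : forall s, is_derive h s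
    (2 * PI * D * d ^ 2 * (Derive a s ^ 2 - m)
     + d * A0 * (Derive (Derive a) s * a s + m))).
  { intros s. unfold h. auto_derive.
    - assert (HEd : ex_derive E s) by (eexists; apply HE). repeat split; trivial.
    - change (fun x : R => E x) with E. rewrite (is_derive_unique _ _ _ (HE s)).
      change (Derive (fun x : R => Derive a x) s) with (Derive (Derive a) s).
      change (Derive (fun x : R => a x) s) with (Derive a s). ring. }
  apply (eigenvalue_ge D L0 (2 * PI / w) (rescale A0 w a) (rescale L0 w l)
           (rescale (- d * w) w (Derive a)) (rescale w w h)).
  - exact HD.
  - exact HL0.
  - exact (period_pos w Hw).
  - intros t. exact (Rmult_lt_0_compat _ _ HL0 (Hlpos _)).
  - exact (rescale_periodic _ _ _ Hw Haper).
  - exact (rescale_periodic _ _ _ Hw Hlper).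
  - exact (rescale_periodic _ _ _ Hw (periodic_Derive 1 a Haper)).
  - apply (rescale_periodic _ _ _ Hw). intros s. unfold h.
    rewrite HEper, Haper, (periodic_Derive 1 a Haper). reflexivity.
  - intros t. exact (ex_derive_rescale _ _ _ t Ha).
  - intros t. exact (ex_derive_rescale _ _ _ t Hl).
  - intros t. exact (ex_derive_rescale _ _ _ t Ha2).
  - intros t. apply ex_derive_rescale. intros s. eexists; apply Hh.
  - exact (Hmu w Hw).
  - intros x t Hx.
    rewrite (is_derive_unique _ _ _
      (is_derive_rescale (- d * w) w (Derive a) t _ (Derive_correct _ _ (Ha2 _)))).
    rewrite (is_derive_unique _ _ _ (is_derive_rescale w w h t _ (Hh _))).
    unfold rescale in *. set (s := w * t / (2 * PI)) in *.
    (* The distance from the left end of the domain. *)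
    set (y := x - A0 * a s).
    assert (Hy : Derive (Derive a) s * y <= L0 * (K * M)).
    { apply Rle_trans with (Rabs (Derive (Derive a) s * y)); [apply Rle_abs|].
      rewrite Rabs_mult, (Rabs_right y) by (unfold y; lra).
      replace (L0 * (K * M)) with (K * (L0 * M)) by ring.
      apply Rmult_le_compat; trivial.
      - apply Rabs_pos.
      - unfold y; lra.
      - apply Rle_trans with (L0 * l s); [unfold y; lra|].
        apply Rmult_le_compat_l; [lra|apply HM]. }
    replace x with (A0 * a s + y) by (unfold y; ring).
    apply Rle_trans with (w ^ 2 / (2 * PI) * d * (A0 * m - L0 * (K * M) - 2 * PI * D * d * m)).
    + apply Req_le. fold g. unfold d. field. lra.
    + assert (Hc : 0 < w ^ 2 / (2 * PI) * d).
      { apply Rmult_lt_0_compat; trivial. apply Rdiv_lt_0_compat; [now apply pow_lt|lra]. }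
      apply Rle_trans with (w ^ 2 / (2 * PI) * d
        * (A0 * m - Derive (Derive a) s * y - 2 * PI * D * d * m)).
      * apply Rmult_le_compat_l; lra.
      * apply Req_le. field. lra.
Qed.

Theorem theorem6 :
  forall (l a : R -> R)
    (Hreg : exists alpha, 0 < alpha /\
              holder_class 2 alpha l /\ holder_class 2 alpha a)
    (Hlper : periodic 1 l) (Haper : periodic 1 a)
    (Hlmin : is_min_on l 0 1 1)
    (Hamax : is_max_on (fun t => Rabs (a t)) 0 1 1),
    (forall (D L0 A0 : R) (mu : R -> R),
       0 < D -> 0 < L0 -> 0 <= A0 -> eigenvalue_family D L0 A0 l a mu ->
       bigO mu (fun w => w ^ 2) /\
       (is_constant a -> bigO mu (fun _ => 1)))
    /\
    (~ is_constant a ->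
     exists C1 C2 : R, 0 < C1 /\
       forall (D L0 A0 : R) (mu : R -> R),
         0 < D -> 0 < L0 -> 0 <= A0 -> eigenvalue_family D L0 A0 l a mu ->
         (A0 / L0 < C1 -> bigO mu (fun _ => 1)) /\
         (A0 / L0 > C2 -> exact_order mu (fun w => w ^ 2))).
Proof.
  intros l a [alpha [Halpha [Hlreg Hareg]]] Hlper Haper [_ Hlmin] [_ Hamax].
  destruct (holder_class_2_bounded alpha l Halpha Hlreg Hlper) as [Hl [Hl2 _]].
  destruct (holder_class_2_bounded alpha a Halpha Hareg Haper) as [Ha [Ha2 [Ka2 [HKa2 Hka2]]]].
  assert (Hl1 : forall s, 1 <= l s).
  { intros s. destruct (periodic_representative 1 s Rlt_0_1) as [y [Hy Hsy]].
    rewrite (Hsy l Hlper). now apply Hlmin. }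
  assert (Ha1 : forall s, Rabs (a s) <= 1).
  { intros s. destruct (periodic_representative 1 s Rlt_0_1) as [y [Hy Hsy]].
    rewrite (Hsy a Haper). now apply Hamax. }
  assert (Hlpos : forall s, 0 < l s) by (intros s; specialize (Hl1 s); lra).
  destruct (periodic_differentiable_bounded 1 l Rlt_0_1 Hlper Hl) as [M [HM0 HM]].
  destruct (periodic_differentiable_bounded 1 (Derive l) Rlt_0_1
              (periodic_Derive 1 l Hlper) Hl2) as [Kl [HKl Hkl]].
  destruct (periodic_differentiable_bounded 1 (Derive a) Rlt_0_1
              (periodic_Derive 1 a Haper) Ha2) as [Ka [HKa Hka]].
  (* A fixed interval contained in the domain at all times carries a bump at
     rest. *)
  assert (Hbounded : forall D L0 A0 mu x0 r, 0 < D -> 0 < L0 ->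
    eigenvalue_family D L0 A0 l a mu -> 0 < r ->
    (forall s, A0 * a s < x0 - r /\ x0 + r < A0 * a s + L0 * l s) ->
    bigO mu (fun _ => 1)).
  { intros D L0 A0 mu x0 r HD HL0 Hmu Hr Hin.
    exists ((3 * D) ^ 2 / (2 * D * r ^ 2)), 0. intros w Hw.
    rewrite Rabs_R1, Rmult_1_r, Rabs_right
      by (apply Rle_ge, (family_nonneg l a D L0 A0 mu); assumption).
    replace (3 * D) with (r * (w / (2 * PI) * 0) + 3 * D) by ring.
    apply (family_le l a D L0 A0 mu) with (x0 := fun _ => x0); trivial.
    - now intros s.
    - intros s. auto_derive. trivial.
    - intros s. rewrite Derive_const, Rabs_R0. lra. }
  (* In general the bump follows the midpoint, at a speed proportional to
     [w]. *)
  assert (Hquad : forall D L0 A0 mu, 0 < D -> 0 < L0 -> 0 <= A0 ->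
    eigenvalue_family D L0 A0 l a mu -> bigO mu (fun w => w ^ 2)).
  { intros D L0 A0 mu HD HL0 HA0 Hmu.
    pose proof PI_RGT_0 as HPI.
    set (r := L0 / 4). set (V := A0 * Ka + L0 / 2 * Kl).
    assert (HV : 0 <= V) by (unfold V; apply Rplus_le_le_0_compat; apply Rmult_le_pos; lra).
    exists ((r * (/ (2 * PI) * V) + 3 * D) ^ 2 / (2 * D * r ^ 2)), 1. intros w Hw.
    rewrite !Rabs_right; [|apply Rle_ge, pow2_ge_0
      |apply Rle_ge, (family_nonneg l a D L0 A0 mu); trivial; lra].
    assert (Hr : 0 < r) by (unfold r; lra).
    assert (Hr2 : 0 < r ^ 2) by (now apply pow_lt).
    apply Rle_trans with ((r * (w / (2 * PI) * V) + 3 * D) ^ 2 / (2 * D * r ^ 2)).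
    - apply (family_le l a D L0 A0 mu) with (x0 := fun s => A0 * a s + L0 / 2 * l s);
        trivial; try lra.
      + intros s. now rewrite Hlper, Haper.
      + intros s. auto_derive. repeat split; trivial.
      + intros s. rewrite Derive_plus, !Derive_scal by (now apply ex_derive_scal).
        eapply Rle_trans; [apply Rabs_triang|]. unfold V. rewrite !Rabs_mult.
        rewrite (Rabs_right A0), (Rabs_right (L0 / 2)) by lra.
        apply Rplus_le_compat; apply Rmult_le_compat_l; trivial; lra.
      + intros s. specialize (Hl1 s). unfold r. split; nra.
    - replace ((r * (/ (2 * PI) * V) + 3 * D) ^ 2 / (2 * D * r ^ 2) * w ^ 2)
        with ((r * (/ (2 * PI) * V) + 3 * D) ^ 2 * w ^ 2 / (2 * D * r ^ 2))
        by (field; lra).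
      apply (Rmult_le_compat_r (/ (2 * D * r ^ 2))).
      { apply Rlt_le, Rinv_0_lt_compat, Rmult_lt_0_compat; lra. }
      rewrite <- Rpow_mult_distr. apply pow_incr.
      assert (0 < / (2 * PI)) by (apply Rinv_0_lt_compat; lra).
      assert (0 <= r * (/ (2 * PI) * V))
        by (apply Rmult_le_pos; [|apply Rmult_le_pos]; lra).
      replace (r * (w / (2 * PI) * V)) with (r * (/ (2 * PI) * V) * w) by (field; lra).
      split; nra. }
  split.
  - intros D L0 A0 mu HD HL0 HA0 Hmu. split; [now apply (Hquad D L0 A0)|].
    intros [c Hc]. apply (Hbounded D L0 A0 mu (A0 * c + L0 / 2) (L0 / 4)); trivial; try lra.
    intros s. rewrite Hc. specialize (Hl1 s). split; nra.
  - intros Hnc.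
    destruct (primitive_of_centred_square a Haper Ha Ha2 Hnc) as [m [E [Hm [HEper HE]]]].
    (* For [A0 < L0 / 2] every [Omega(t)] contains the interval from [A0] to
       [L0 - A0]. *)
    exists (1 / 2), (Ka2 * M / m). split; [lra|].
    intros D L0 A0 mu HD HL0 HA0 Hmu. split; intros Hratio.
    + apply (Rlt_div_l A0 (1 / 2) L0 HL0) in Hratio.
      apply (Hbounded D L0 A0 mu (L0 / 2) ((L0 - 2 * A0) / 4)); trivial; try lra.
      intros s. specialize (Hl1 s).
      pose proof (proj1 (Rabs_le_between _ _) (Ha1 s)).
      split; nra.
    + split; [now apply (Hquad D L0 A0)|].
      apply Rgt_lt, (Rlt_div_r (Ka2 * M / m) A0 L0 HL0) in Hratio.
      set (k := (A0 * m - L0 * (Ka2 * M)) ^ 2 / (16 * PI ^ 2 * D * m)).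
      pose proof PI_RGT_0.
      assert (Hgap : L0 * (Ka2 * M) < A0 * m).
      { apply Rmult_lt_compat_r with (r := m) in Hratio; trivial.
        replace (Ka2 * M / m * L0 * m) with (L0 * (Ka2 * M)) in Hratio by (field; lra).
        exact Hratio. }
      assert (Hk : 0 < k).
      { unfold k. apply Rdiv_lt_0_compat; [apply pow_lt; lra|].
        apply Rmult_lt_0_compat; [apply Rmult_lt_0_compat|]; trivial.
        apply Rmult_lt_0_compat; [lra|now apply pow_lt]. }
      exists (/ k), 0. intros w Hw.
      assert (Hge : k * w ^ 2 <= mu w).
      { apply (family_ge l a D L0 A0 mu) with (E := E); trivial.
        intros s. apply Rle_trans with (2 := HM s), Rle_abs. }
      assert (0 <= w ^ 2) by apply pow2_ge_0.
      rewrite !Rabs_right by nra.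
      apply Rmult_le_reg_l with k; trivial.
      rewrite <- Rmult_assoc, Rinv_r by lra. lra.
Qed.
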